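(* Let $\alpha$ be an irrational real number, $k,r\ge1$ integers, $\lambda_1,\dots,\lambda_k\in\mathbb{R}$ and $N_1,\dots,N_k\ge1$ integers. Let $$S=S_{\alpha,\lambda_1,\dots,\lambda_k}(N_1,\dots,N_k)=\{\{\alpha n_i+\lambda_i\}:1\le n_i\le N_i,\ i=1,\dots,k\}\subset\mathbb{R}/\mathbb{Z}.$$ Then $S$ has at most $(2r+1)k$ distinct consecutive $r$--differences.
   Context: $\{x\}$ is the fractional part; $\mathbb{R}/\mathbb{Z}$ is identified with $[0,1)$ with its natural order. Writing $S=\{a_1<\dots<a_M\}$ with cyclic indexing $a_{i+M}=a_i$ and differences taken in $\mathbb{R}/\mathbb{Z}$, the consecutive $r$--differences of $S$ are the $r$-tuples $(a_{i+1}-a_i,\dots,a_{i+r}-a_{i+r-1})$, $1\le i\le M$; the claim is that at most $(2r+1)k$ distinct such tuples occur. *)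

(* Defs.v *)
From HB Require Import structures.
From mathcomp Require Import all_boot all_order all_algebra.
From mathcomp Require Import finmap.
From mathcomp Require Import boolp classical_sets reals.

Set Implicit Arguments.
Unset Strict Implicit.
Unset Printing Implicit Defensive.

Import Order.TTheory GRing.Theory Num.Theory.
Local Open Scope ring_scope.
Local Open Scope fset_scope.

(* R/Z is represented by [0, 1): the class of x is represented by frac_part x, so
   the difference of a and b in R/Z is frac_part (a - b). *)
Definition frac_part (R : realType) (x : R) : R := x - (Num.floor x)%:~R.

Definition point_set (R : realType) (k : nat) (alpha : R) (lambda : 'I_k -> R)
    (N : 'I_k -> nat) : {fset R} :=
  [fset frac_part (alpha * n%:R + lambda i) | i in 'I_k, n in iota 1 (N i)].

(* Points are numbered from 0: cyc_point S m is a_{m+1} in the usual numbering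
   a_1 < ... < a_M, with a_{i+M} = a_i. *)
Definition cyc_point (R : realType) (S : {fset R}) (m : nat) : R :=
  nth 0 (sort <=%R (enum_fset S)) (m %% #|` S|)%N.

Definition consecutive_diff (R : realType) (S : {fset R}) (r i : nat) :
    r.-tuple R :=
  [tuple frac_part (cyc_point S (i + j).+1%N - cyc_point S (i + j)%N) | j < r].

Definition consecutive_diffs (R : realType) (S : {fset R}) (r : nat) :
    {fset r.-tuple R} :=
  [fset consecutive_diff S r i | i in iota 0 #|` S|].

(* Main.v *)
(* Translate a window of r + 1 consecutive points of S by alpha. If the image is
   again a window, its r-differences are unchanged; since alpha is irrational the
   translates cannot all stay in the finite set S, so every r-difference is
   realised by a window whose translate is not a window. For such a window either
   one of its r + 1 points is the last point of one of the k progressions, or the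
   first point of one of them lies inside one of its r translated gaps. This leaves
   at most k (r + 1) + k r windows. *)
Require Import Defs.
From mathcomp Require Import all_boot all_order all_algebra.
From mathcomp Require Import finmap.
From mathcomp Require Import boolp classical_sets reals.
From mathcomp Require Import zify ring lra.

Set Implicit Arguments.
Unset Strict Implicit.
Unset Printing Implicit Defensive.

Import Order.TTheory GRing.Theory Num.Theory.

Local Open Scope fset_scope.

(** Choosing one related [c] for each [x] gives a map to [C], injective by the second hypothesis.
    [C] will be the labels recording why the translate of a window fails to be a window. *)
Lemma leq_card_rel (T : choiceType) (C : finType) (A : {fset T})
    (e : T -> C -> bool) :
  (forall x, x \in A -> exists c, e x c) ->
  (forall x y c, x \in A -> y \in A -> e x c -> e y c -> x = y) ->
  #|` A| <= #|C|.
Proof.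
move=> e_total e_inj.
pose f (x : A) := xchoose (e_total (val x) (valP x)).
have f_inj : injective f.
  move=> x y fxy; apply: val_inj.
  apply: (e_inj _ _ (f x) (valP x) (valP y)); first exact: xchooseP.
  rewrite fxy; exact: xchooseP.
by rewrite cardfE; apply: leq_card f_inj.
Qed.

(** * Fractional parts and arithmetic modulo 1 *)

Section FractionalPart.
Local Open Scope ring_scope.

Lemma frac_part_itv (R : realType) (x : R) : 0 <= frac_part x < 1.
Proof.
have /andP[] := floor_itv x; rewrite /frac_part intrD => h1 h2.
by apply/andP; split; lra.
Qed.

Lemma frac_part_small (R : realType) (x : R) : 0 <= x < 1 -> frac_part x = x.
Proof.
move=> hx; rewrite /frac_part (@floor_def _ x 0) ?subr0 //.
Qed.

Lemma frac_part_eq (R : realType) (x y : R) :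
  frac_part x = frac_part y <-> exists z : int, x - y = z%:~R.
Proof.
split=> [|[z hz]].
  rewrite /frac_part => h; exists (Num.floor x - Num.floor y).
  by rewrite intrB; lra.
have -> : x = y + z%:~R by lra.
rewrite /frac_part (@floor_def _ _ (Num.floor y + z)) ?intrD; first by lra.
by have /andP[] := floor_itv y; rewrite !intrD => *; apply/andP; split; lra.
Qed.

Lemma frac_partDl (R : realType) (x y : R) :
  frac_part (frac_part x + y) = frac_part (x + y).
Proof.
apply/frac_part_eq; exists (- Num.floor x).
by rewrite intrN /frac_part; ring.
Qed.

Lemma frac_part_addr_inj (R : realType) (c x y : R) :
  0 <= x < 1 -> 0 <= y < 1 ->
  frac_part (x + c) = frac_part (y + c) -> x = y.
Proof.
move=> hx hy /frac_part_eq[z hz].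
rewrite -(frac_part_small hx) -(frac_part_small hy).
by apply/frac_part_eq; exists z; lra.
Qed.

Lemma frac_partB_translate (R : realType) (c x y : R) :
  frac_part (frac_part (y + c) - frac_part (x + c)) = frac_part (y - x).
Proof.
apply/frac_part_eq; exists (Num.floor (x + c) - Num.floor (y + c)).
by rewrite intrB /frac_part; ring.
Qed.

(** A coincidence makes [alpha * (m - n)] an integer [z], so [m <> n] would give the rational value
    [z / (m - n)] for [alpha]. *)
Lemma frac_partM_inj (R : realType) (alpha x : R) : irrational alpha ->
  injective (fun n : nat => frac_part (x + alpha * n%:R)).
Proof.
move=> irr m n /= /frac_part_eq[z hz].
apply/eqP; apply: contra_notT irr => neq_mn.
exists (z%:Q / (m%:Q - n%:Q)) => //.
rewrite fmorph_div rmorphB /= !ratr_int -hz.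
have : (m%:R - n%:R : R) != 0 by rewrite subr_eq0 eqr_nat.
by rewrite -!pmulrn => ?; field.
Qed.

End FractionalPart.

(** * The cyclic successor in a finite subset of the circle *)

Section CyclicSuccessor.
Local Open Scope ring_scope.

(** Successors are taken of points, not indices, because translation by [alpha] acts on points and
    does not respect their numbering. *)
Definition cyc_succ (R : realType) (S : {fset R}) (x : R) : R :=
  cyc_point S (index x (sort <=%R (enum_fset S))).+1.

Lemma mem_cyc_point (R : realType) (S : {fset R}) (m : nat) :
  (0 < #|` S|)%N -> cyc_point S m \in S.
Proof.
move=> S_gt0; have /(mem_nth 0) : (m %% #|` S| < size (sort <=%R (enum_fset S)))%N.
  by rewrite size_sort ltn_mod.
by rewrite mem_sort.
Qed.

Lemma cyc_pointP (R : realType) (S : {fset R}) (x : R) : x \in S ->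
  exists2 m, (m < #|` S|)%N & x = cyc_point S m.
Proof.
move=> xS; have xs : x \in sort <=%R (enum_fset S) by rewrite mem_sort.
exists (index x (sort <=%R (enum_fset S))).
  by move: xs; rewrite -index_mem size_sort.
rewrite /cyc_point modn_small ?nth_index //.
by move: xs; rewrite -index_mem size_sort.
Qed.

Lemma cyc_point_eq (R : realType) (S : {fset R}) (m n : nat) :
  (0 < #|` S|)%N ->
  (cyc_point S m == cyc_point S n) = (m == n %[mod #|` S|]).
Proof.
by move=> S_gt0; rewrite nth_uniq ?size_sort ?ltn_mod ?sort_uniq ?fset_uniq.
Qed.

Lemma cyc_succ_point (R : realType) (S : {fset R}) (m : nat) :
  (0 < #|` S|)%N -> cyc_succ S (cyc_point S m) = cyc_point S m.+1.
Proof.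
move=> S_gt0; rewrite /cyc_succ {2}/cyc_point index_uniq; first last.
- by rewrite sort_uniq fset_uniq.
- by rewrite size_sort ltn_mod.
by apply/eqP; rewrite cyc_point_eq // -[(_ %% _).+1]addn1 modnDml addn1.
Qed.

Lemma iter_cyc_succ (R : realType) (S : {fset R}) (m j : nat) :
  (0 < #|` S|)%N -> iter j (cyc_succ S) (cyc_point S m) = cyc_point S (m + j).
Proof.
move=> S_gt0; elim: j => [|j IHj]; first by rewrite addn0.
by rewrite iterS IHj cyc_succ_point // addnS.
Qed.

Lemma cyc_succ_mem (R : realType) (S : {fset R}) (x : R) :
  x \in S -> cyc_succ S x \in S.
Proof. by move=> xS; rewrite mem_cyc_point // cardfs_gt0; apply/fset0Pn; exists x. Qed.

Lemma iter_cyc_succ_mem (R : realType) (S : {fset R}) (x : R) (j : nat) :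
  x \in S -> iter j (cyc_succ S) x \in S.
Proof. by move=> xS; elim: j => [|j IHj] //=; exact: cyc_succ_mem. Qed.

Lemma cyc_succ_inj (R : realType) (S : {fset R}) :
  {in S &, injective (cyc_succ S)}.
Proof.
move=> x y /cyc_pointP[m m_lt ->] /cyc_pointP[n n_lt ->].
have S_gt0 : (0 < #|` S|)%N by exact: leq_ltn_trans m_lt.
rewrite !cyc_succ_point // => /eqP; rewrite cyc_point_eq //.
by rewrite -addn1 -[n.+1]addn1 eqn_modDr !modn_small // => /eqP->.
Qed.

Lemma iter_cyc_succ_inj (R : realType) (S : {fset R}) (j : nat) :
  {in S &, injective (iter j (cyc_succ S))}.
Proof.
elim: j => [//|j IHj] x y xS yS /= /cyc_succ_inj.
by rewrite !iter_cyc_succ_mem // => /(_ isT isT) /IHj->.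
Qed.

Lemma cyc_point_lt (R : realType) (S : {fset R}) (m n : nat) :
  (m < #|` S|)%N -> (n < #|` S|)%N ->
  (cyc_point S m < cyc_point S n) = (m < n)%N.
Proof.
move=> m_lt n_lt; rewrite /cyc_point !modn_small //.
by rewrite lt_sorted_ltn_nth ?inE ?size_sort ?sort_lt_sorted ?fset_uniq.
Qed.

(** This describes the successor by circular distance, which is invariant under translation, unlike
    the order on [0, 1). *)
Lemma cyc_succ_nearest (R : realType) (S : {fset R}) (x y : R) :
  {in S, forall z, 0 <= z < 1} -> x \in S -> y \in S -> y != x ->
  cyc_succ S x != x /\ frac_part (cyc_succ S x - x) <= frac_part (y - x).
Proof.
move=> S_itv /cyc_pointP[m m_lt ->] /cyc_pointP[n n_lt ->].
have S_gt0 : (0 < #|` S|)%N by exact: leq_ltn_trans m_lt.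
have p_itv i : 0 <= cyc_point S i < 1 by rewrite S_itv ?mem_cyc_point.
rewrite cyc_succ_point // cyc_point_eq // !modn_small // => neq_nm.
have fracB u v : 0 <= u < 1 -> 0 <= v < 1 ->
    frac_part (v - u) = if u <= v then v - u else v - u + 1.
  move=> /andP[? ?] /andP[? ?]; case: leP => uv.
    by rewrite frac_part_small //; apply/andP; split; lra.
  rewrite -[RHS]frac_part_small; last by apply/andP; split; lra.
  by apply/frac_part_eq; exists (-1); rewrite intrN; lra.
have leE i j : (i < #|` S|)%N -> (j < #|` S|)%N ->
    (cyc_point S i <= cyc_point S j) = (i <= j)%N.
  by move=> ? ?; rewrite leNgt cyc_point_lt // -leqNgt.
have /andP[? ?] := p_itv n.
case: (ltnP m.+1 #|` S|) => [m1_lt|m1_ge].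
  split; first by rewrite cyc_point_eq // !modn_small // neq_ltn ltnSn orbT.
  rewrite !fracB // !leE // leqnSn.
  have /andP[? ?] := p_itv m.+1; case: leqP => [le_mn|_]; last by lra.
  by rewrite lerD2r leE // ltn_neqAle eq_sym neq_nm.
(* Here [x] is the last point: its successor wraps around to index 0 and [y] lies below [x], so both
   differences pick up the same 1. *)
have m1E : m.+1 = #|` S| by apply/eqP; rewrite eqn_leq m_lt.
have -> : cyc_point S m.+1 = cyc_point S 0.
  by apply/eqP; rewrite cyc_point_eq // m1E modnn mod0n.
have m_gt0 : (0 < m)%N by move: neq_nm n_lt; lia.
split; first by rewrite cyc_point_eq // !modn_small // eq_sym -lt0n.
have lt_nm : (n < m)%N by move: neq_nm n_lt; lia.
rewrite !fracB // !leE // leqNgt m_gt0 /= leqNgt lt_nm /=.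
by rewrite !lerD2r leE.
Qed.

(* A new point strictly inside the translated gap would have to be a translate
   of a point of [S] lying inside the original gap. *)
Lemma cyc_succ_translate (R : realType) (S : {fset R}) (alpha b d : R) :
  {in S, forall z, 0 <= z < 1} ->
  b \in S -> d \in S -> frac_part (b + alpha) \in S ->
  frac_part (cyc_succ S b + alpha) \in S ->
  cyc_succ S (frac_part (b + alpha)) = frac_part (d + alpha) ->
  cyc_succ S (frac_part (b + alpha)) = frac_part (cyc_succ S b + alpha).
Proof.
move=> S_itv bS dS TbS TsbS; set Tb := frac_part (b + alpha) in TbS *.
set Tsb := frac_part (cyc_succ S b + alpha) in TsbS * => sTbE.
(* In the degenerate case [b] is its own successor, which is possible only if [S] is a singleton. *)
have [TsbE|neq_Tsb] := eqVneq Tsb Tb.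
  have sbE : cyc_succ S b = b.
    by apply: frac_part_addr_inj TsbE; rewrite S_itv ?cyc_succ_mem.
  have [dbE|neq_db] := eqVneq d b; first by rewrite sTbE dbE TsbE.
  by have [] := cyc_succ_nearest S_itv bS dS neq_db; rewrite sbE eqxx.
have [neq_sTb] := cyc_succ_nearest S_itv TbS TsbS neq_Tsb.
rewrite sTbE in neq_sTb *.
have neq_db : d != b by apply: contra neq_sTb => /eqP->.
(* Nearest-point minimality at the translate of [b] puts [d] no farther from [b] than
   [cyc_succ S b]; minimality at [b] gives the converse. *)
rewrite !frac_partB_translate => le_d.
have [_ le_sb] := cyc_succ_nearest S_itv bS dS neq_db.
have /frac_part_addr_inj-> // : frac_part (d - b) = frac_part (cyc_succ S b - b).
- by apply/eqP; rewrite eq_le le_d.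
- exact: S_itv.
- by rewrite S_itv ?cyc_succ_mem.
Qed.

Lemma consecutive_diff_iter (R : realType) (S : {fset R}) (r m : nat) :
  (0 < #|` S|)%N -> consecutive_diff S r m =
  [tuple frac_part (iter j.+1 (cyc_succ S) (cyc_point S m) -
                    iter j (cyc_succ S) (cyc_point S m)) | j < r].
Proof.
move=> S_gt0; apply: eq_from_tnth => j.
by rewrite !tnth_mktuple !iter_cyc_succ // addnS.
Qed.

End CyclicSuccessor.

(** * Ends of the progressions and obstructions to translating a window *)

Section PointSet.
Local Open Scope ring_scope.

Lemma point_setP (R : realType) (k : nat) (alpha : R) (lambda : 'I_k -> R)
    (N : 'I_k -> nat) (x : R) :
  reflect (exists i n, (1 <= n <= N i)%N /\ x = frac_part (alpha * n%:R + lambda i))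
          (x \in point_set alpha lambda N).
Proof.
apply: (iffP idP) => [/imfset2P[/= i _ [n]]|[i [n [n_itv ->]]]].
  by rewrite mem_iota add1n ltnS => n_itv ->; exists i, n.
by apply/imfset2P; exists i => //; exists n => //=; rewrite mem_iota add1n ltnS.
Qed.

Lemma point_set_itv (R : realType) (k : nat) (alpha : R) (lambda : 'I_k -> R)
    (N : 'I_k -> nat) :
  {in point_set alpha lambda N, forall x, 0 <= x < 1}.
Proof. by move=> x /point_setP[i [n [_ ->]]]; exact: frac_part_itv. Qed.

(** If [x] has index [n < N i], its translate is the term of index [n + 1] of the same
    progression. *)
Lemma point_set_last (R : realType) (k : nat) (alpha : R) (lambda : 'I_k -> R)
    (N : 'I_k -> nat) (x : R) :
  x \in point_set alpha lambda N ->
  frac_part (x + alpha) \notin point_set alpha lambda N ->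
  exists i, x = frac_part (alpha * (N i)%:R + lambda i).
Proof.
move=> /point_setP[i [n [/andP[n_ge1 n_le] ->]]] notS.
exists i; move: n_le; rewrite leq_eqVlt => /orP[/eqP->//|n_lt].
case/negP: notS; apply/point_setP; exists i, n.+1; split => //.
by rewrite frac_partDl; congr frac_part; rewrite -[n.+1%:R]natr1; ring.
Qed.

(** A term of index at least 2 is the translate of the preceding term of its progression. *)
Lemma point_set_first (R : realType) (k : nat) (alpha : R) (lambda : 'I_k -> R)
    (N : 'I_k -> nat) (x : R) :
  x \in point_set alpha lambda N ->
  (forall y, y \in point_set alpha lambda N -> x <> frac_part (y + alpha)) ->
  exists i, x = frac_part (alpha + lambda i).
Proof.
move=> /point_setP[i [[|[|n]] [/andP[// _ n_le] ->]]] noPred; exists i.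
  by rewrite mulr1.
case: (noPred (frac_part (alpha * n.+1%:R + lambda i))).
  by apply/point_setP; exists i, n.+1; split => //; exact: ltnW.
by rewrite frac_partDl; congr frac_part; rewrite -[n.+2%:R]natr1; ring.
Qed.

(* [inl j] records that the [j]-th successor of [x] is a last point of a
   progression, [inr j] that a first point lies in the translate of the [j]-th
   gap after [x]. *)
Definition blocks (R : realType) (k : nat) (alpha : R) (lambda : 'I_k -> R)
    (N : 'I_k -> nat) (r : nat) (x : R) (c : 'I_k * ('I_r.+1 + 'I_r)) : bool :=
  let S := point_set alpha lambda N in
  match c.2 with
  | inl j => iter j (cyc_succ S) x == frac_part (alpha * (N c.1)%:R + lambda c.1)
  | inr j => let y := frac_part (iter j (cyc_succ S) x + alpha) in
             (y \in S) && (cyc_succ S y == frac_part (alpha + lambda c.1))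
  end.
#[global] Arguments blocks {R k} alpha lambda N r x c.

(** A label fixes an end point of a progression; [x] is recovered from it by undoing successors and,
    for [inr], the translation, all injective on [S]. *)
Lemma blocks_inj (R : realType) (k : nat) (alpha : R) (lambda : 'I_k -> R)
    (N : 'I_k -> nat) (r : nat) (x y : R) (c : 'I_k * ('I_r.+1 + 'I_r)) :
  x \in point_set alpha lambda N -> y \in point_set alpha lambda N ->
  blocks alpha lambda N r x c -> blocks alpha lambda N r y c -> x = y.
Proof.
move=> xS yS; case: c => l [] j; rewrite /blocks /=.
  by move=> /eqP <- /eqP/esym; exact: iter_cyc_succ_inj.
case/andP=> TxS /eqP <- /andP[TyS /eqP/esym] /cyc_succ_inj.
move=> /(_ TxS TyS) /frac_part_addr_inj h.
apply: (iter_cyc_succ_inj xS yS); apply: h; apply: (@point_set_itv _ _ alpha lambda N);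
  exact: iter_cyc_succ_mem.
Qed.

(** Without [inl] labels every point of the window has its translate in [S]. Without [inr] labels
    the successor of each of the first [r] translates is itself a translate, so [cyc_succ_translate]
    applies gap by gap. *)
Lemma iter_cyc_succ_translate (R : realType) (k : nat) (alpha : R)
    (lambda : 'I_k -> R) (N : 'I_k -> nat) (r : nat) (x : R) :
  let S := point_set alpha lambda N in
  x \in S -> ~ (exists c, blocks alpha lambda N r x c) ->
  forall j, (j <= r)%N ->
    frac_part (iter j (cyc_succ S) x + alpha) \in S /\
    iter j (cyc_succ S) (frac_part (x + alpha)) =
      frac_part (iter j (cyc_succ S) x + alpha).
Proof.
move=> S xS free.
have TS j : (j <= r)%N -> frac_part (iter j (cyc_succ S) x + alpha) \in S.
  rewrite -ltnS => j_lt; apply/negPn/negP => /point_set_last.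
  rewrite iter_cyc_succ_mem // => /(_ isT)[l lE].
  by apply: free; exists (l, inl (Ordinal j_lt)); rewrite /blocks /= lE.
move=> j j_le; split; first exact: TS.
elim: j j_le => [//|j IHj] j_lt; rewrite !iterS IHj ?(ltnW j_lt) //.
have TjS := TS _ (ltnW j_lt).
have [d dS dE] : exists2 d, d \in S &
    cyc_succ S (frac_part (iter j (cyc_succ S) x + alpha)) = frac_part (d + alpha).
  apply: contrapT => noPred; apply: free.
  have [|l lE] := point_set_first (cyc_succ_mem TjS).
    by move=> y yS yE; apply: noPred; exists y.
  by exists (l, inr (Ordinal j_lt)); rewrite /blocks /= TjS lE eqxx.
apply: cyc_succ_translate dE => //; first exact: point_set_itv.
  exact: iter_cyc_succ_mem.
exact: TS j_lt.
Qed.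

End PointSet.

Theorem theorem3p4 (R : realType) (alpha : R) (k r : nat)
    (lambda : 'I_k -> R) (N : 'I_k -> nat)
    (halpha : irrational alpha)
    (hk : (1 <= k)%N) (hr : (1 <= r)%N)
    (hN : forall i : 'I_k, (1 <= N i)%N) :
  (#|` consecutive_diffs (point_set alpha lambda N) r| <= (2 * r + 1) * k)%N.
Proof.
set S := point_set alpha lambda N.
pose s := cyc_succ S; pose T x := frac_part (x + alpha)%R.
pose D x : r.-tuple R := [tuple frac_part (iter j.+1 s x - iter j s x)%R | j < r].
pose B := [fset x in S | `[< exists c, blocks alpha lambda N r x c >]].
have B_card : #|` B| <= (2 * r + 1) * k.
  (* Each progression contributes [r + 1] labels for its last point and [r] for its first. *)
  have -> : (2 * r + 1) * k = #|{: 'I_k * ('I_r.+1 + 'I_r)}|.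
    by rewrite card_prod card_sum !card_ord; lia.
  apply: (@leq_card_rel _ _ _ (blocks alpha lambda N r)) => [x|x y c].
    by rewrite !inE => /andP[_ /asboolP].
  by rewrite !inE => /andP[xS _] /andP[yS _]; exact: blocks_inj.
have D_translate x : x \in S -> x \notin B -> T x \in S /\ D (T x) = D x.
  move=> xS; rewrite !inE xS /= => /asboolP free.
  have step := iter_cyc_succ_translate xS free.
  split; first by have [] := step 0 isT.
  apply: eq_from_tnth => j; rewrite !tnth_mktuple.
  have [_ ->] := step j.+1 (ltn_ord j); have [_ ->] := step j (ltnW (ltn_ord j)).
  exact: frac_partB_translate.
have D_bad x : x \in S -> exists2 y, y \in B & D y = D x.
  move=> xS; apply: contrapT => noBad.
  (* If no point of [B] shares the tuple [D x], the orbit of [x] never meets [B] and hence never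
     leaves [S]. *)
  have orbit n : iter n T x \in S /\ D (iter n T x) = D x.
    elim: n => [//|n [TnS DTn]]; rewrite iterS -DTn; apply: D_translate => //.
    by apply/negP => TnB; apply: noBad; exists (iter n T x).
  have iterE n : iter n T x = frac_part (x + alpha * n%:R)%R.
    elim: n => [|n IHn]; first by rewrite mulr0 addr0 frac_part_small // (point_set_itv xS).
    rewrite iterS IHn /T frac_partDl; congr frac_part.
    by rewrite -[n.+1%:R%R]natr1; ring.
  have T_inj : injective (fun n => iter n T x).
    by move=> m n /=; rewrite !iterE; exact: frac_partM_inj.
  (* Pigeonhole: one more distinct orbit point than [S] has elements. *)
  suff : size (map (fun n => iter n T x) (iota 0 #|` S|.+1)) <= #|` S|.
    by rewrite size_map size_iota ltnn.
  apply: uniq_leq_size; first by rewrite map_inj_uniq ?iota_uniq.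
  by move=> _ /mapP[n _ ->]; case: (orbit n).
(* Every tuple that occurs is [D y] for some [y] in [B], so counting [B] suffices. *)
apply: leq_trans B_card; apply: (@leq_trans #|` [fset D x | x in B]|).
  apply: fsubset_leq_card; apply/fsubsetP => _ /imfsetP[m /= m_lt ->].
  have S_gt0 : 0 < #|` S| by move: m_lt; rewrite mem_iota; case: #|` S|.
  have [y yB yE] := D_bad _ (mem_cyc_point m S_gt0).
  by rewrite consecutive_diff_iter // -/(D _) -yE; apply/imfsetP; exists y.
by apply: leq_trans (leq_imfset_card _ _ _) _.
Qed.
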